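(* On the pseudosphere $\mathbb{S}^{2,4}=\{x\in\mathbb{R}^7: x_1^2+x_2^2+x_3^2-x_4^2-x_5^2-x_6^2-x_7^2=1\}$ there exist integrable almost complex structures (that is, complex structures).
   Context: $\mathbb{S}^{2,4}$ is regarded as a smooth $6$-dimensional submanifold of $\mathbb{R}^7$. An almost complex structure is a field $J$ of endomorphisms of the tangent bundle with $J^2=-\mathrm{Id}$; it is integrable if it comes from a complex manifold structure. No compatibility with the pseudo-Riemannian metric is claimed. *)

(* Defs.v *)
From HB Require Import structures.
From mathcomp Require Import all_boot all_order all_algebra.
From mathcomp Require Import all_classical all_reals all_analysis.
From mathcomp Require Import complex.

Set Implicit Arguments.
Unset Strict Implicit.
Unset Printing Implicit Defensive.

Import Order.TTheory GRing.Theory Num.Theory.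
Import numFieldNormedType.Exports.

Local Open Scope classical_set_scope.
Local Open Scope ring_scope.

(* Naming the structure is necessary: the type complex R carries no topology
   of its own, only its numFieldType structure induces one. *)
Definition Cspace (R : realType) (n : nat) : normedModType R[i] := 'rV[R[i]]_n.

(* C^n is identified with R^(n + n) by (x, y) |-> x + i y. *)
Definition toC (R : realType) (n : nat) (v : 'rV[R]_(n + n)) : Cspace R n :=
  \row_k (lsubmx v 0 k +i* rsubmx v 0 k)%C.

Definition toR (R : realType) (n : nat) (z : Cspace R n) : 'rV[R]_(n + n) :=
  row_mx (map_mx (@complex.Re R) (z : 'rV[R[i]]_n))
         (map_mx (@complex.Im R) (z : 'rV[R[i]]_n)).

(* For U open and V finite-dimensional this is the class C^k on U. *)
Fixpoint Ck (R : realType) (V W : normedModType R) (k : nat) (U : set V)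
    (f : V -> W) : Prop :=
  match k with
  | 0 => forall x, U x -> {for x, continuous f}
  | k'.+1 => (forall x, U x -> differentiable f x) /\
             (forall v : V, Ck k' U ('D_v f))
  end.

(* Smoothness (C^oo) on an arbitrary subset A, in particular on an embedded
   submanifold: f has smooth local extensions to the ambient space. *)
Definition smooth_on (R : realType) (V W : normedModType R) (A : set V)
    (f : V -> W) : Prop :=
  forall x, A x -> exists (O : set V) (F : V -> W),
    [/\ open O, O x, (forall k, Ck k O F)
      & forall y, (A `&` O) y -> F y = f y].

Definition holomorphic_on (R : realType) (m n : nat) (U : set (Cspace R m))
    (f : Cspace R m -> Cspace R n) : Prop :=
  forall z, U z -> differentiable f z.

Definition q24 (R : realType) (x : 'rV[R]_7) : R :=
  \sum_(i < 7 | (i < 3)%N) x 0 i ^+ 2 - \sum_(i < 7 | (3 <= i)%N) x 0 i ^+ 2.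

Definition S24 (R : realType) : set 'rV[R]_7 := [set x | q24 x = 1].

(* 1 is a regular value of q24, so T_x S24 is the kernel of its differential. *)
Definition tangent (R : realType) (x : 'rV[R]_7) : set 'rV[R]_7 :=
  [set v | 'd (@q24 R) x v = 0].

(* The endomorphism of T_x S24 is v |-> v *m J x; only the restriction of J x
   to T_x S24 matters.  Every smooth field of endomorphisms of the tangent
   bundle is of this form: extend it by 0 on the Euclidean normal lines. *)
Definition almost_complex_structure (R : realType)
    (J : 'rV[R]_7 -> 'M[R]_7) : Prop :=
  [/\ smooth_on (@S24 R) J,
      forall x v, S24 x -> tangent x v -> tangent x (v *m J x)
    & forall x v, S24 x -> tangent x v -> v *m J x *m J x = - v].

Record chart (R : realType) := Chart {
  chart_dom : set 'rV[R]_7;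
  chart_cod : set (Cspace R 3);
  chart_coord : 'rV[R]_7 -> Cspace R 3;
  chart_param : Cspace R 3 -> 'rV[R]_7
}.

(* A diffeomorphism from an open subset of S24 onto an open subset of C^3;
   the values of the two maps outside their domains are irrelevant. *)
Definition smooth_chart (R : realType) (c : chart R) : Prop :=
  [/\ exists2 O : set 'rV[R]_7, open O & chart_dom c = @S24 R `&` O,
      open (chart_cod c),
      forall x, chart_dom c x ->
        chart_cod c (chart_coord c x) /\ chart_param c (chart_coord c x) = x,
      forall z, chart_cod c z ->
        chart_dom c (chart_param c z) /\ chart_coord c (chart_param c z) = z
    & smooth_on (chart_dom c) (@toR R 3 \o chart_coord c) /\
      smooth_on (@toC R 3 @^-1` chart_cod c) (chart_param c \o @toC R 3)].

(* A complex manifold structure on S24 whose underlying smooth structure is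
   that of S24 as a submanifold of R^7. *)
Definition holomorphic_atlas (R : realType) (A : set (chart R)) : Prop :=
  [/\ forall c, A c -> smooth_chart c,
      forall x, S24 x -> exists2 c, A c & chart_dom c x
    & forall c d, A c -> A d ->
        holomorphic_on (chart_cod c `&` chart_param c @^-1` chart_dom d)
                       (chart_coord d \o chart_param c)].

(* In every chart of A, J corresponds to multiplication by i: with p the
   parametrization inverse to the chart, dp_u (i w) = J (dp_u w). *)
Definition induces (R : realType) (A : set (chart R))
    (J : 'rV[R]_7 -> 'M[R]_7) : Prop :=
  forall c, A c -> forall u w : 'rV[R]_(3 + 3), chart_cod c (toC u) ->
    let p := chart_param c \o @toC R 3 in
    'd p u (toR ('i%C *: toC w)) = 'd p u w *m J (p u).

Definition integrable_structure (R : realType)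
    (J : 'rV[R]_7 -> 'M[R]_7) : Prop :=
  exists2 A : set (chart R), holomorphic_atlas A & induces A J.

(* Main.v *)
Require Import Defs.
From mathcomp Require Import all_boot all_order all_algebra.
From mathcomp Require Import all_classical all_reals all_analysis.
From mathcomp Require Import complex ring.

Set Implicit Arguments.
Unset Strict Implicit.
Unset Printing Implicit Defensive.

Import Order.TTheory GRing.Theory Num.Theory.
Import numFieldNormedType.Exports.

Local Open Scope classical_set_scope.
Local Open Scope ring_scope.

(** The pseudosphere is diffeomorphic to S^2 x R^4: writing a point as (X, y)
with X in R^3 and y in R^4, the equation says |X|^2 = 1 + |y|^2, so that
(X, y) |-> (X / |X|, y) is a diffeomorphism.  Since S^2 is the Riemann sphere
and R^4 is C^2, the pseudosphere carries the complex structure of CP^1 x C^2.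

Transporting the product structure gives an explicit field ([J24]).  With
r = sqrt (1 + |y|^2), which is |X| on the pseudosphere, and with i acting on
R^4 = C^2, it sends a tangent vector (xi, eta) to

  ((xi x X) / r + ((y . i eta) / r^2) X, i eta),

the second summand being what keeps the result tangent.  That its square is
- Id ([J24_sqr]) is the triple product identity for vectors of R^3, and its
smoothness is that of r, which extends to all of R^7 ([smooth_J24]).

The atlas has two charts, the stereographic projections of X / r from the
two poles (0, 0, e) with e = 1 and e = -1, completed by the coordinates y1 + i y2
and y3 + i y4.  Each is onto C^3 ([stereoK], [paramK]).  The two are exchanged by
(w, a, b) |-> (1 / w, a, b) ([stereo_transition]), which gives a holomorphic
atlas ([stereo_atlas]).  That this atlas induces [J24] ([param_holomorphic]) is
an identity between rational functions of the coordinates and r, checked on the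
explicit differential of the parametrizations ([diff_param]).

The iterated directional derivatives that define C^k are handled through
closure properties: C^k functions on an open set are stable under sums,
products, inverses and square roots of positive functions. *)

(** * Differentials *)

Lemma is_diff_near0 (K : numFieldType) (V W : normedModType K) (f : V -> W)
    (x : V) :
  (\forall y \near x, f y = 0) -> is_diff x f (fun=> 0).
Proof.
move=> f0; have fx0 : f x = 0 by exact: nbhs_singleton f0.
pose z : {linear V -> W} := \0.
have zc : continuous z by move=> y; exact: cvg_cst.
have dz : f \o shift x = cst (f x) + z +o_ 0 id.
  apply/eqaddoP => _/posnumP[e]; near=> h.
  have -> : (f \o shift x - (cst (f x) + z)) h = 0.
    rewrite fctE /= !fctE /= fx0 /z /= addr0 subr0.
    near: h.
    by have := f0; rewrite (near_shift 0) /=; apply: filterS => h; rewrite subr0.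
  by rewrite normr0 mulr_ge0.
have dE : 'd f x = z :> (V -> W) by exact: diff_unique.
apply: DiffDef; last by rewrite dE.
by apply/diff_locallyP; rewrite dE.
Unshelve. all: by end_near. Qed.

(** The difference g - f vanishes near x, hence has differential 0 there, and
g = f + (g - f). *)
Lemma is_diff_near (K : numFieldType) (V W : normedModType K) (f g df : V -> W)
    (x : V) :
  (\forall y \near x, f y = g y) -> is_diff x f df -> is_diff x g df.
Proof.
move=> fg dfx.
have d0 : is_diff x (g - f) (fun=> 0).
  apply: is_diff_near0; move: fg; apply: filterS => y fgy.
  by rewrite !fctE fgy subrr.
have [dD dE] := is_diffD dfx d0.
have fgE : f + (g - f) = g by rewrite addrC subrK.
by rewrite fgE in dD dE; apply: DiffDef; rewrite // dE addr0.
Qed.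

Lemma is_diff_coord (K : numFieldType) m n (i : 'I_m) (j : 'I_n)
    (x : 'M[K]_(m, n)) :
  is_diff x (fun y : 'M[K]_(m, n) => y i j : K) (fun y => y i j).
Proof.
have @f : {linear 'M[K]_(m, n) -> K}.
  by exists (fun N : 'M[K]_(_, _) => N i j); do 2![eexists]; do ?[constructor];
     rewrite ?mxE// => ? *; rewrite ?mxE//; move=> ?; rewrite !mxE.
have fc : continuous f by exact: coord_continuous.
apply: (@DiffDef _ _ _ _ _ f f); first exact: linear_differentiable.
by rewrite diff_lin.
Qed.

Lemma is_diff_const (K : numFieldType) (V W : normedModType K) (a : W) (x : V) :
  is_diff x (fun=> a) (fun=> 0).
Proof. exact: is_diff_cst. Qed.

Lemma is_diff_add (K : numFieldType) (V W : normedModType K)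
    (f g df dg : V -> W) (x : V) :
  is_diff x f df -> is_diff x g dg ->
  is_diff x (fun y => f y + g y) (fun v => df v + dg v).
Proof. by move=> ? ?; exact: (is_diffD (f := f) (g := g)). Qed.

Lemma is_diff_opp (K : numFieldType) (V W : normedModType K) (f df : V -> W)
    (x : V) :
  is_diff x f df -> is_diff x (fun y => - f y) (fun v => - df v).
Proof. by move=> ?; exact: (is_diffN (f := f)). Qed.

Lemma is_diff_mul (K : numFieldType) (V : normedModType K) (f g df dg : V -> K)
    (x : V) :
  is_diff x f df -> is_diff x g dg ->
  is_diff x (fun y => f y * g y) (fun v => f x * dg v + g x * df v).
Proof. by move=> ? ?; exact: (is_diffM (f := f) (g := g)). Qed.

Lemma is_diff_inv (K : numFieldType) (V : normedModType K) (f df : V -> K)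
    (x : V) : f x != 0 ->
  is_diff x f df ->
  is_diff x (fun y => (f y)^-1) (fun v => - ((f x)^-1 * (f x)^-1 * df v)).
Proof.
move=> f0 dfx; apply: DiffDef; first exact: differentiableV.
rewrite diffV// funeqE => v /=; rewrite diff_val scaleNr; congr (- _).
by rewrite expr2 invfM.
Qed.

Lemma is_diff_sqrt (R : realType) (V : normedModType R) (f df : V -> R)
    (x : V) : 0 < f x ->
  is_diff x f df ->
  is_diff x (fun y => Num.sqrt (f y)) (fun v => (2 * Num.sqrt (f x))^-1 * df v).
Proof.
move=> f0 dfx.
have ds := is_derive1_sqrt f0.
have dsd : is_diff (f x) (@Num.sqrt R) (fun h => h * (2 * Num.sqrt (f x))^-1).
  have sd : differentiable (@Num.sqrt R) (f x).
    by apply/derivable1_diffP; exact: ex_derive.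
  apply: DiffDef => //.
  by rewrite diff1E// derive1E derive_val.
have := is_diff_comp dfx dsd => dcomp.
apply: (is_diff_eq (f := @Num.sqrt R \o f)).
by rewrite funeqE => v /=; rewrite mulrC.
Qed.

Lemma is_diff_scalev (K : numFieldType) (V W : normedModType K) (f df : V -> K)
    (w : W) (x : V) :
  is_diff x f df -> is_diff x (fun y => f y *: w) (fun v => df v *: w).
Proof.
move=> dfx; apply: DiffDef; first exact: differentiableZl.
by rewrite diffZl// diff_val.
Qed.

Lemma diff_coord (K : numFieldType) (V : normedModType K) m n
    (f : V -> 'M[K]_(m, n)) (df : V -> K) (x v : V) i j :
  differentiable f x ->
  is_diff x (fun y => f y i j) df -> ('d f x v) i j = df v.
Proof.
move=> dfx dfj.
have := is_diff_comp (differentiableP dfx) (is_diff_coord i j (f x)).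
by move=> [_ /(congr1 (fun g => g v)) /= <-]; rewrite diff_val.
Qed.

(** * Calculus of functions of class C^k *)

(** Openness of U matters: the directional derivatives at a point of U must see
only values in U. *)
Lemma Ck_ext (R : realType) (V W : normedModType R) k (U : set V)
    (f g : V -> W) : open U -> (forall x, U x -> f x = g x) ->
  Ck k U f -> Ck k U g.
Proof.
move=> oU; elim: k f g => [|k IH] f g fg /=.
  move=> fc x Ux; have : f @ x --> g x by rewrite -fg//; exact: fc.
  apply: cvg_trans; apply: near_eq_cvg.
  by move: (open_nbhs_nbhs (conj oU Ux)); apply: filterS => y /fg ->.
have nfg x : U x -> \forall y \near x, f y = g y.
  move=> Ux.
  by move: (open_nbhs_nbhs (conj oU Ux)); apply: filterS => y /fg.
move=> [df Df]; split.
  by move=> x Ux; case: (is_diff_near (nfg x Ux) (differentiableP (df x Ux))).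
move=> v; apply: IH (Df v) => x Ux; apply: near_eq_derive; exact: nfg.
Qed.

(** Turns a formula for the differential at the points of U into the next class
of differentiability; each closure property below is an induction on k whose
step applies this to the corresponding rule of differentiation. *)
Lemma CkSr (R : realType) (V W : normedModType R) k (U : set V) (f : V -> W)
    (df : V -> V -> W) : open U -> (forall x, U x -> is_diff x f (df x)) ->
  (forall v, Ck k U (df^~ v)) -> Ck k.+1 U f.
Proof.
move=> oU dfU Df; split; first by move=> x /dfU [].
move=> v; apply: Ck_ext (Df v) => // x /dfU [dx dE].
by rewrite deriveE// dE.
Qed.

Lemma CkS_is_diff (R : realType) (V W : normedModType R) k (U : set V)
    (f : V -> W) (x : V) : Ck k.+1 U f -> U x -> is_diff x f (fun v => 'D_v f x).
Proof.
move=> [df _] Ux; apply: DiffDef; first exact: df.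
by rewrite funeqE => v; rewrite deriveE//; exact: df.
Qed.

Lemma Ck_pred (R : realType) (V W : normedModType R) k (U : set V)
    (f : V -> W) : Ck k.+1 U f -> Ck k U f.
Proof.
elim: k f => [|k IH] f [df Df].
  by move=> x Ux; exact: differentiable_continuous (df x Ux).
by split=> // v; exact: IH.
Qed.

Lemma Ck_const (R : realType) (V W : normedModType R) k (U : set V) (a : W) :
  open U -> Ck k U (fun _ : V => a).
Proof.
move=> oU; elim: k a => [|k IH] a; first by move=> x _; exact: cvg_cst.
by apply: (CkSr oU (fun x _ => is_diff_const a x)) => v; exact: IH.
Qed.

Lemma Ck_coord (R : realType) k m n (U : set 'M[R]_(m, n)) i j :
  open U -> Ck k U (fun x : 'M[R]_(m, n) => x i j : R).
Proof.
move=> oU; case: k => [|k]; first by move=> x _; exact: coord_continuous.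
apply: (CkSr oU (fun x _ => is_diff_coord i j x)) => v.
exact: Ck_const.
Qed.

Lemma CkD (R : realType) (V W : normedModType R) k (U : set V) (f g : V -> W) :
  open U -> Ck k U f -> Ck k U g -> Ck k U (fun x => f x + g x).
Proof.
move=> oU; elim: k f g => [|k IH] f g Cf Cg.
  by move=> x Ux; apply: cvgD; [exact: Cf|exact: Cg].
apply: (CkSr oU (fun x Ux => is_diff_add (CkS_is_diff Cf Ux) (CkS_is_diff Cg Ux))) => v.
by apply: IH; [exact: (Cf.2)|exact: (Cg.2)].
Qed.

Lemma CkN (R : realType) (V W : normedModType R) k (U : set V) (f : V -> W) :
  open U -> Ck k U f -> Ck k U (fun x => - f x).
Proof.
move=> oU; elim: k f => [|k IH] f Cf.
  by move=> x Ux; apply: cvgN; exact: Cf.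
apply: (CkSr oU (fun x Ux => is_diff_opp (CkS_is_diff Cf Ux))) => v.
by apply: IH; exact: (Cf.2).
Qed.

Lemma CkM (R : realType) (V : normedModType R) k (U : set V) (f g : V -> R) :
  open U -> Ck k U f -> Ck k U g -> Ck k U (fun x => f x * g x).
Proof.
move=> oU; elim: k f g => [|k IH] f g Cf Cg.
  by move=> x Ux; apply: cvgM; [exact: Cf|exact: Cg].
apply: (CkSr oU (fun x Ux => is_diff_mul (CkS_is_diff Cf Ux) (CkS_is_diff Cg Ux))) => v.
by apply: CkD => //; apply: IH; (exact: Ck_pred || exact: (Cf.2) || exact: (Cg.2)).
Qed.

Lemma CkV (R : realType) (V : normedModType R) k (U : set V) (f : V -> R) :
  open U -> (forall x, U x -> f x != 0) ->
  Ck k U f -> Ck k U (fun x => (f x)^-1).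
Proof.
move=> oU f0; elim: k f f0 => [|k IH] f f0 Cf.
  by move=> x Ux; apply: cvgV; [exact: f0|exact: Cf].
apply: (CkSr oU (fun x Ux => is_diff_inv (f0 x Ux) (CkS_is_diff Cf Ux))) => v.
have Ci := IH f f0 (Ck_pred Cf).
by apply: CkN => //; apply: CkM => //; [exact: CkM|exact: (Cf.2)].
Qed.

(** The derivative of sqrt f is f' / (2 sqrt f), and sqrt f itself is C^k by
induction. *)
Lemma Ck_sqrt (R : realType) (V : normedModType R) k (U : set V) (f : V -> R) :
  open U -> (forall x, U x -> 0 < f x) ->
  Ck k U f -> Ck k U (fun x => Num.sqrt (f x)).
Proof.
move=> oU f0; elim: k f f0 => [|k IH] f f0 Cf.
  move=> x Ux; apply: (@continuous_comp _ _ _ f (@Num.sqrt R)).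
    exact: Cf.
  exact: sqrt_continuous.
apply: (CkSr oU (fun x Ux => is_diff_sqrt (f0 x Ux) (CkS_is_diff Cf Ux))) => v.
apply: CkM => //; last exact: (Cf.2).
apply: CkV => //.
  by move=> x Ux; rewrite mulf_neq0 ?pnatr_eq0// gt_eqF// sqrtr_gt0 f0.
apply: CkM => //; first exact: Ck_const.
exact: IH f0 (Ck_pred Cf).
Qed.

Lemma Ck_scalev (R : realType) (V W : normedModType R) k (U : set V)
    (f : V -> R) (w : W) :
  open U -> Ck k U f -> Ck k U (fun x => f x *: w).
Proof.
move=> oU; elim: k f => [|k IH] f Cf.
  by move=> x Ux; apply: cvgZ; [exact: Cf|exact: cvg_cst].
apply: (CkSr oU (fun x Ux => is_diff_scalev w (CkS_is_diff Cf Ux))) => v.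
by apply: IH; exact: (Cf.2).
Qed.

Lemma Ck_sum (R : realType) (V W : normedModType R) (I : Type) k (U : set V)
    (s : seq I) (f : I -> V -> W) :
  open U -> (forall i, Ck k U (f i)) -> Ck k U (fun x => \sum_(i <- s) f i x).
Proof.
move=> oU Cf; elim: s => [|i s IH].
  by apply: Ck_ext oU _ (Ck_const _ 0 oU) => x _; rewrite big_nil.
by apply: Ck_ext oU _ (CkD oU (Cf i) IH) => x _; rewrite big_cons.
Qed.

Lemma Ck_mx (R : realType) (V : normedModType R) k m n (U : set V)
    (f : V -> 'M[R]_(m, n)) :
  open U -> (forall i j, Ck k U (fun x => f x i j : R)) -> Ck k U f.
Proof.
move=> oU Cf.
have Cs : Ck k U (fun x => \sum_i \sum_j f x i j *: (delta_mx i j : 'M[R]_(m, n))).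
  by do 2 (apply: Ck_sum => // ?); exact: Ck_scalev.
by apply: Ck_ext oU _ Cs => x _; rewrite -matrix_sum_delta.
Qed.

(** * The almost complex structure *)

Local Notation "x $[ k ]" := (x 0 (inord k)) (at level 2, format "x $[ k ]").

(** Indices are kept in the form inord k, so that entries of vectors given by a
list of coordinates compute. *)
Lemma inord7_ind (P : 'I_7 -> Prop) :
  P (inord 0) -> P (inord 1) -> P (inord 2) -> P (inord 3) -> P (inord 4) ->
  P (inord 5) -> P (inord 6) -> forall j, P j.
Proof.
move=> P0 P1 P2 P3 P4 P5 P6 j; rewrite -(inord_val j).
by case: j => [[|[|[|[|[|[|[|]]]]]]]] //=.
Qed.

Lemma inord6_ind (P : 'I_(3 + 3) -> Prop) :
  P (inord 0) -> P (inord 1) -> P (inord 2) -> P (inord 3) -> P (inord 4) ->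
  P (inord 5) -> forall j, P j.
Proof.
move=> P0 P1 P2 P3 P4 P5 j; rewrite -(inord_val (j : 'I_6)).
by case: j => [[|[|[|[|[|[|]]]]]]] //=.
Qed.

Lemma sum_ord7 (V : nmodType) (F : 'I_7 -> V) :
  \sum_i F i = F (inord 0) + F (inord 1) + F (inord 2) + F (inord 3)
               + F (inord 4) + F (inord 5) + F (inord 6).
Proof.
rewrite 7!big_ord_recr big_ord0 /= add0r.
by do ![congr (_ + _)]; congr F; apply: val_inj; rewrite /= inordK.
Qed.

(** The number r: on the pseudosphere it is the Euclidean norm of the first
three coordinates, but this expression in the last four is positive and smooth
on the whole of R^7. *)
Definition rad (R : realType) (x : 'rV[R]_7) : R :=
  Num.sqrt (1 + x$[3] ^+ 2 + x$[4] ^+ 2 + x$[5] ^+ 2 + x$[6] ^+ 2).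

Lemma q24E (R : realType) (x : 'rV[R]_7) : q24 x =
  x$[0] ^+ 2 + x$[1] ^+ 2 + x$[2] ^+ 2
  - (x$[3] ^+ 2 + x$[4] ^+ 2 + x$[5] ^+ 2 + x$[6] ^+ 2).
Proof.
rewrite /q24 (big_mkcond (fun i : 'I_7 => (i < 3)%N)).
rewrite (big_mkcond (fun i : 'I_7 => (3 <= i)%N)) !sum_ord7 !inordK //=.
by rewrite !addr0 !add0r.
Qed.

Lemma rad_arg_gt0 (R : realType) (a b c d : R) :
  0 < 1 + a ^+ 2 + b ^+ 2 + c ^+ 2 + d ^+ 2.
Proof. by rewrite !ltr_wpDr ?sqr_ge0. Qed.

Lemma rad_gt0 (R : realType) (x : 'rV[R]_7) : 0 < rad x.
Proof. by rewrite sqrtr_gt0 rad_arg_gt0. Qed.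

Lemma sqr_rad (R : realType) (x : 'rV[R]_7) :
  rad x ^+ 2 = 1 + x$[3] ^+ 2 + x$[4] ^+ 2 + x$[5] ^+ 2 + x$[6] ^+ 2.
Proof. by rewrite sqr_sqrtr// ltW// rad_arg_gt0. Qed.

Lemma S24_rad (R : realType) (x : 'rV[R]_7) : S24 x ->
  x$[0] ^+ 2 + x$[1] ^+ 2 + x$[2] ^+ 2 = rad x ^+ 2.
Proof.
rewrite /S24 /= q24E sqr_rad => /eqP; rewrite subr_eq => /eqP ->.
by rewrite !addrA.
Qed.

(** The i-th row is the image of the i-th basis vector; [mul_J24] recovers the
formula with the cross product. *)
Definition J24 (R : realType) (x : 'rV[R]_7) : 'M[R]_7 :=
  \matrix_(i < 7, j < 7)
    let X := x$[0] in let Y := x$[1] in let Z := x$[2] in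
    let q := (rad x)^-1 in
    nth 0 (nth [::]
     [:: [:: 0; - (q * Z); q * Y; 0; 0; 0; 0];
         [:: q * Z; 0; - (q * X); 0; 0; 0; 0];
         [:: - (q * Y); q * X; 0; 0; 0; 0; 0];
         [:: q * q * x$[4] * X; q * q * x$[4] * Y; q * q * x$[4] * Z; 0; 1; 0; 0];
         [:: - (q * q * x$[3] * X); - (q * q * x$[3] * Y); - (q * q * x$[3] * Z);
             - 1; 0; 0; 0];
         [:: q * q * x$[6] * X; q * q * x$[6] * Y; q * q * x$[6] * Z; 0; 0; 0; 1];
         [:: - (q * q * x$[5] * X); - (q * q * x$[5] * Y); - (q * q * x$[5] * Z);
             0; 0; - 1; 0]] i) j.

Lemma diff_q24 (R : realType) (x v : 'rV[R]_7) : 'd (@q24 R) x v =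
  2 * (x$[0] * v$[0] + x$[1] * v$[1] + x$[2] * v$[2]
       - (x$[3] * v$[3] + x$[4] * v$[4] + x$[5] * v$[5] + x$[6] * v$[6])).
Proof.
pose c k : 'rV[R]_7 -> R := fun y => y$[k].
have -> : @q24 R = fun y => c 0%N y * c 0%N y + c 1%N y * c 1%N y
   + c 2%N y * c 2%N y - (c 3%N y * c 3%N y + c 4%N y * c 4%N y
   + c 5%N y * c 5%N y + c 6%N y * c 6%N y).
  by rewrite funeqE => y; rewrite q24E !expr2.
have sq k : is_diff x (fun y => c k y * c k y) (fun v => c k x * c k v + c k x * c k v).
  by apply: is_diff_mul; exact: is_diff_coord.
have [_ ->] := is_diff_add (is_diff_add (is_diff_add (sq 0%N) (sq 1%N)) (sq 2%N))
  (is_diff_opp (is_diff_add (is_diff_add (is_diff_add (sq 3%N) (sq 4%N)) (sq 5%N)) (sq 6%N))).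
rewrite /c; ring.
Qed.

Lemma tangentE (R : realType) (x v : 'rV[R]_7) : tangent x v <->
  x$[0] * v$[0] + x$[1] * v$[1] + x$[2] * v$[2]
  = x$[3] * v$[3] + x$[4] * v$[4] + x$[5] * v$[5] + x$[6] * v$[6].
Proof.
rewrite /tangent /= diff_q24; split.
  by move=> /eqP; rewrite mulf_eq0 pnatr_eq0/= subr_eq0 => /eqP.
by move=> ->; rewrite subrr mulr0.
Qed.

Lemma mul_J24 (R : realType) (x v : 'rV[R]_7) (q := (rad x)^-1)
    (c := q * q * (v$[3] * x$[4] - v$[4] * x$[3] + v$[5] * x$[6] - v$[6] * x$[5])) :
  v *m J24 x = \row_(j < 7) nth 0
   [:: q * (v$[1] * x$[2] - v$[2] * x$[1]) + c * x$[0];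
       q * (v$[2] * x$[0] - v$[0] * x$[2]) + c * x$[1];
       q * (v$[0] * x$[1] - v$[1] * x$[0]) + c * x$[2];
       - v$[4]; v$[3]; - v$[6]; v$[5]] j.
Proof.
apply/rowP => j; rewrite !mxE sum_ord7 !mxE !inordK// -/q /c.
by elim/inord7_ind: j; rewrite !inordK//=; ring.
Qed.

(** Reduces the class C^k of a polynomial expression to that of its ingredients
in the context. *)
Ltac smooth := do ?[assumption|apply: CkD => //|apply: CkM => //
  |apply: CkN => //|apply: Ck_coord => //|apply: Ck_const => //].

Lemma Ck_rad (R : realType) k (U : set 'rV[R]_7) : open U -> Ck k U (@rad R).
Proof. by move=> oU; apply: Ck_sqrt => // [x _|]; [exact: rad_arg_gt0|smooth]. Qed.

(** The cross product is orthogonal to X, so the scalar product with X only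
sees the multiple of X in the formula: it is (|X|^2 / r^2) (y . i eta), and
|X| = r. *)
Lemma J24_tangent (R : realType) (x v : 'rV[R]_7) :
  S24 x -> tangent x (v *m J24 x).
Proof.
move=> Sx; apply/tangentE; rewrite mul_J24 !mxE !inordK//=.
have r0 : rad x != 0 by rewrite gt_eqF// rad_gt0.
have := S24_rad Sx.
set c := v$[3] * _ - _ + _ - _; set X := x$[0]; set Y := x$[1]; set Z := x$[2].
move=> rE; apply: (@eq_trans _ _ c); last by rewrite /c; ring.
transitivity ((rad x)^-1 * (rad x)^-1 * c * (X ^+ 2 + Y ^+ 2 + Z ^+ 2)).
  by ring.
by rewrite rE; field.
Qed.

(** The triple product identity (xi x X) x X = (X . xi) X - |X|^2 xi, where
X . xi = y . eta by tangency; the multiple of X in the image is killed by the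
cross product and its own multiple of X is - (y . eta) / r^2. *)
Lemma J24_sqr (R : realType) (x v : 'rV[R]_7) :
  S24 x -> tangent x v -> v *m J24 x *m J24 x = - v.
Proof.
move=> Sx /tangentE Tv.
have r0 : rad x != 0 by rewrite gt_eqF// rad_gt0.
have := S24_rad Sx.
rewrite (mul_J24 x v) mul_J24 !mxE !inordK//=.
set q := (rad x)^-1; set X := x$[0]; set Y := x$[1]; set Z := x$[2] => rE.
have q1 : q * q * (X ^+ 2 + Y ^+ 2 + Z ^+ 2) = 1 by rewrite rE /q; field.
(* Multiplying w by q^2 |X|^2 = 1 and adding a multiple of X . xi - y . eta = 0
   turns each of the first three coordinates into a polynomial identity. *)
have key (w W : R) :
    w = q * q * (X ^+ 2 + Y ^+ 2 + Z ^+ 2) * w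
      + q * q * (X * v$[0] + Y * v$[1] + Z * v$[2]
      - (x$[3] * v$[3] + x$[4] * v$[4] + x$[5] * v$[5] + x$[6] * v$[6])) * W.
  by rewrite q1 Tv; ring.
apply/rowP => j; rewrite !mxE; elim/inord7_ind: j; rewrite !inordK//=.
- by rewrite [X in _ = - X](key _ (- X)); ring.
- by rewrite [X in _ = - X](key _ (- Y)); ring.
- by rewrite [X in _ = - X](key _ (- Z)); ring.
Qed.

Lemma smooth_J24 (R : realType) : smooth_on (@S24 R) (@J24 R).
Proof.
move=> x _; exists setT, (@J24 R); split=> //; first exact: openT.
move=> k.
have o : open [set: 'rV[R]_7] := openT.
have Cq : Ck k setT (fun x => (rad x)^-1 : R).
  by apply: CkV (Ck_rad k o) => // y _; rewrite gt_eqF// rad_gt0.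
apply: Ck_mx => // i j.
elim/inord7_ind: i; elim/inord7_ind: j.
all: apply: Ck_ext (o) _ _; first by move=> y _; rewrite mxE !inordK.
all: by rewrite /=; smooth.
Qed.

(** * Stereographic charts *)

Lemma toRK (R : realType) n : cancel (@toR R n) (@toC R n).
Proof.
move=> z; apply/rowP => k; rewrite mxE row_mxKl row_mxKr !mxE.
by case: (z 0 k).
Qed.

Lemma toCK (R : realType) n : cancel (@toC R n) (@toR R n).
Proof.
move=> v; rewrite -[RHS]hsubmxK.
by congr row_mx; apply/rowP => k; rewrite !mxE.
Qed.

(** Stereographic projection of X / r from the pole (0, 0, e) with e = 1 or
- 1: the first complex coordinate is (X0 + i e X1) / (r - e X2).  The sign e in
front of X1 makes both charts compatible with the same orientation of the
sphere.  The first three entries are the real parts, the last three the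
imaginary parts of the three complex coordinates. *)
Definition stereo (R : realType) (e : R) (x : 'rV[R]_7) : 'rV[R]_(3 + 3) :=
  let d := (rad x - e * x$[2])^-1 in
  \row_(j < 3 + 3)
    nth 0 [:: x$[0] * d; x$[3]; x$[5]; e * x$[1] * d; x$[4]; x$[6]] j.

(** The number r at the point parametrized by u: the entries 1, 4, 2, 5 of u are
the coordinates y1, y2, y3, y4. *)
Definition rad_param (R : realType) (u : 'rV[R]_(3 + 3)) : R :=
  Num.sqrt (1 + u$[1] ^+ 2 + u$[4] ^+ 2 + u$[2] ^+ 2 + u$[5] ^+ 2).

(** 1 + |w|^2, for w the first complex coordinate of u. *)
Definition norm_param (R : realType) (u : 'rV[R]_(3 + 3)) : R :=
  1 + u$[0] ^+ 2 + u$[3] ^+ 2.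

(** Inverse stereographic projection, scaled by r:
X = r (2 Re w, 2 e Im w, e (|w|^2 - 1)) / (1 + |w|^2). *)
Definition param (R : realType) (e : R) (u : 'rV[R]_(3 + 3)) : 'rV[R]_7 :=
  let s := rad_param u * (norm_param u)^-1 in
  \row_(j < 7)
    nth 0 [:: 2 * u$[0] * s; 2 * e * u$[3] * s;
              e * (u$[0] ^+ 2 + u$[3] ^+ 2 - 1) * s;
              u$[1]; u$[4]; u$[2]; u$[5]] j.

Definition stereo_dom (R : realType) (e : R) : set 'rV[R]_7 :=
  [set x | rad x - e * x$[2] != 0].

Definition stereo_chart (R : realType) (e : R) : chart R :=
  Chart (@S24 R `&` stereo_dom e) setT (@toC R 3 \o stereo e)
    (param e \o @toR R 3).

Lemma rad_param_gt0 (R : realType) (u : 'rV[R]_(3 + 3)) : 0 < rad_param u.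
Proof. by rewrite sqrtr_gt0 rad_arg_gt0. Qed.

Lemma norm_param_gt0 (R : realType) (u : 'rV[R]_(3 + 3)) : 0 < norm_param u.
Proof. by rewrite !ltr_wpDr ?sqr_ge0. Qed.

Lemma rad_paramE (R : realType) (e : R) (u : 'rV[R]_(3 + 3)) :
  rad (param e u) = rad_param u.
Proof. by rewrite /rad !mxE !inordK. Qed.

Lemma param_S24 (R : realType) (e : R) (u : 'rV[R]_(3 + 3)) :
  e ^+ 2 = 1 -> S24 (param e u).
Proof.
move=> e1; rewrite /S24 /= q24E.
have n0 : norm_param u != 0 by rewrite gt_eqF// norm_param_gt0.
have := sqr_rad (param e u); rewrite rad_paramE => rE.
apply/eqP; rewrite subr_eq !addrA -rE !mxE !inordK//=; apply/eqP.
rewrite !exprMn e1 exprVn mulr1 mul1r /norm_param in n0 *.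
by field.
Qed.

Lemma param_pole (R : realType) (e : R) (u : 'rV[R]_(3 + 3)) :
  e ^+ 2 = 1 ->
  rad (param e u) - e * (param e u)$[2] = 2 * rad_param u / norm_param u.
Proof.
rewrite expr2 => e1; rewrite rad_paramE !mxE !inordK//= !mulrA e1 mul1r.
have n0 : norm_param u != 0 by rewrite gt_eqF// norm_param_gt0.
have -> : u$[0] ^+ 2 + u$[3] ^+ 2 - 1 = norm_param u - 2.
  by rewrite /norm_param; ring.
by field.
Qed.

(** The point lies in the domain of the other chart exactly when w is nonzero. *)
Lemma param_antipole (R : realType) (e : R) (u : 'rV[R]_(3 + 3)) :
  e ^+ 2 = 1 ->
  rad (param e u) - - e * (param e u)$[2] =
  2 * rad_param u * (u$[0] ^+ 2 + u$[3] ^+ 2) / norm_param u.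
Proof.
rewrite expr2 => e1; rewrite rad_paramE !mxE !inordK//= mulNr opprK !mulrA e1 mul1r.
have n0 : norm_param u != 0 by rewrite gt_eqF// norm_param_gt0.
by move: n0; rewrite /norm_param => n0; field.
Qed.

Lemma rad_stereo (R : realType) (e : R) (x : 'rV[R]_7) :
  rad_param (stereo e x) = rad x.
Proof. by rewrite /rad_param !mxE !inordK. Qed.

(** Since X0^2 + X1^2 = r^2 - X2^2 = (r - e X2) (r + e X2), the square norm of the
first coordinate is (r + e X2) / (r - e X2). *)
Lemma norm_stereo (R : realType) (e : R) (x : 'rV[R]_7) :
  e ^+ 2 = 1 -> S24 x -> stereo_dom e x ->
  norm_param (stereo e x) = 2 * rad x / (rad x - e * x$[2]).
Proof.
move=> e1 Sx; rewrite /stereo_dom /= => dx.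
rewrite /norm_param !mxE !inordK//= !exprMn e1 mul1r.
have -> : x$[1] ^+ 2 = rad x ^+ 2 - x$[0] ^+ 2 - e ^+ 2 * x$[2] ^+ 2.
  by rewrite -(S24_rad Sx) e1; ring.
by field.
Qed.

Lemma stereoK (R : realType) (e : R) (x : 'rV[R]_7) :
  e ^+ 2 = 1 -> S24 x -> stereo_dom e x -> param e (stereo e x) = x.
Proof.
move=> e1 Sx dx.
have r0 : rad x != 0 by rewrite gt_eqF// rad_gt0.
have nE := norm_stereo e1 Sx dx.
have ab : (stereo e x)$[0] ^+ 2 + (stereo e x)$[3] ^+ 2 - 1
          = norm_param (stereo e x) - 2 by rewrite /norm_param; ring.
move: dx; rewrite /stereo_dom /= => dx.
have eM y : y = e ^+ 2 * y by rewrite e1 mul1r.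
apply/rowP => j; rewrite [LHS]mxE rad_stereo ab nE !mxE !inordK//=.
elim/inord7_ind: j; rewrite !inordK//=.
- by field; rewrite r0 dx.
- by rewrite [RHS]eM; field; rewrite r0 dx.
- by rewrite [RHS]eM; field; rewrite r0 dx.
Qed.

Lemma paramK (R : realType) (e : R) (u : 'rV[R]_(3 + 3)) :
  e ^+ 2 = 1 -> stereo e (param e u) = u.
Proof.
move=> e1.
have r0 : rad_param u != 0 by rewrite gt_eqF// rad_param_gt0.
have n0 : norm_param u != 0 by rewrite gt_eqF// norm_param_gt0.
have eM y : y = e ^+ 2 * y by rewrite e1 mul1r.
apply/rowP => j; rewrite [LHS]mxE param_pole// !mxE !inordK//=.
elim/inord6_ind: j; rewrite !inordK//=.
- by field; rewrite r0 n0.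
- by rewrite [RHS]eM; field; rewrite r0 n0.
Qed.

(** The first complex coordinate becomes the conjugate of w over |w|^2, that is
1 / w. *)
Lemma stereo_param_opp (R : realType) (e : R) (u : 'rV[R]_(3 + 3)) :
  e ^+ 2 = 1 -> u$[0] ^+ 2 + u$[3] ^+ 2 != 0 ->
  stereo (- e) (param e u) = \row_(j < 3 + 3)
    nth 0 [:: u$[0] / (u$[0] ^+ 2 + u$[3] ^+ 2); u$[1]; u$[2];
              - (u$[3] / (u$[0] ^+ 2 + u$[3] ^+ 2)); u$[4]; u$[5]] j.
Proof.
move=> e1 u0.
have r0 : rad_param u != 0 by rewrite gt_eqF// rad_param_gt0.
have n0 : norm_param u != 0 by rewrite gt_eqF// norm_param_gt0.
have eM y : y = e ^+ 2 * y by rewrite e1 mul1r.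
apply/rowP => j; rewrite [LHS]mxE param_antipole// !mxE !inordK//=.
elim/inord6_ind: j; rewrite !inordK//=.
- by field; rewrite r0 n0 u0.
- by rewrite [RHS]eM; field; rewrite r0 n0 u0.
Qed.

Lemma stereo_dom_param (R : realType) (e : R) (u : 'rV[R]_(3 + 3)) :
  e ^+ 2 = 1 -> stereo_dom e (param e u).
Proof.
move=> e1; rewrite /stereo_dom /= param_pole// gt_eqF//.
by rewrite divr_gt0 ?norm_param_gt0// mulr_gt0 ?rad_param_gt0.
Qed.

Lemma stereo_dom_param_opp (R : realType) (e : R) (u : 'rV[R]_(3 + 3)) :
  e ^+ 2 = 1 -> stereo_dom (- e) (param e u) ->
  u$[0] ^+ 2 + u$[3] ^+ 2 != 0.
Proof.
move=> e1; rewrite /stereo_dom /= param_antipole//.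
by apply: contra => /eqP ->; rewrite mulr0 mul0r.
Qed.

Lemma open_stereo_dom (R : realType) (e : R) : open (stereo_dom e).
Proof.
have oT : open [set: 'rV[R]_7] := openT.
pose f (x : 'rV[R]_7) := rad x - e * x$[2].
have cf : Ck 0 setT f by have := Ck_rad 0 oT; rewrite /f => ?; smooth.
have -> : stereo_dom e = f @^-1` [set y | y != 0] by [].
by apply: open_comp => [x _|]; [exact: cf|exact: open_neq].
Qed.

Lemma Ck_stereo (R : realType) (e : R) k : Ck k (stereo_dom e) (stereo e).
Proof.
have oU : open (stereo_dom e) by exact: open_stereo_dom.
have Cr := Ck_rad k oU.
have Cd : Ck k (stereo_dom e) (fun x => (rad x - e * x$[2])^-1).
  by apply: CkV => //; smooth.
apply: Ck_mx => // i j; rewrite (ord1 i) {i}.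
elim/inord6_ind: j.
all: apply: Ck_ext (oU) _ _; first by move=> y _; rewrite mxE !inordK.
all: by rewrite /=; smooth.
Qed.

Lemma Ck_param (R : realType) (e : R) k : Ck k setT (param e).
Proof.
have oU : open [set: 'rV[R]_(3 + 3)] := openT.
have Cr : Ck k [set: 'rV[R]_(3 + 3)] (@rad_param R).
  by apply: Ck_sqrt => // [x _|]; [exact: rad_arg_gt0|smooth].
have Cn : Ck k [set: 'rV[R]_(3 + 3)] (fun u => (norm_param u)^-1).
  apply: CkV => // [u _|]; first by rewrite gt_eqF// norm_param_gt0.
  by rewrite /norm_param; smooth.
apply: Ck_mx => // i j; rewrite (ord1 i) {i}.
elim/inord7_ind: j.
all: apply: Ck_ext (oU) _ _; first by move=> y _; rewrite mxE !inordK.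
all: by rewrite /=; smooth.
Qed.

Lemma smooth_stereo_chart (R : realType) (e : R) :
  e ^+ 2 = 1 -> smooth_chart (stereo_chart e).
Proof.
move=> e1; split => /=.
- by exists (stereo_dom e) => //; exact: open_stereo_dom.
- exact: openT.
- by move=> x [Sx dx]; split=> //; rewrite toCK stereoK.
- move=> z _; rewrite paramK// toRK; split=> //; split.
    exact: param_S24.
  exact: stereo_dom_param.
split.
- move=> x [_ dx]; exists (stereo_dom e), (stereo e); split=> //.
  + exact: open_stereo_dom.
  + exact: Ck_stereo.
  + by move=> y _ /=; rewrite toCK.
- move=> u _; exists setT, (param e); split=> //.
  + exact: openT.
  + exact: Ck_param.
  + by move=> y _ /=; rewrite toCK.
Qed.

Lemma differentiable_row (K : numFieldType) (V : normedModType K) n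
    (f : V -> 'rV[K]_n) (x : V) :
  (forall j, differentiable (fun y => f y 0 j : K) x) -> differentiable f x.
Proof.
move=> df.
have -> : f = \sum_(j < n) (fun y => f y 0 j *: (delta_mx 0 j : 'rV[K]_n)).
  by rewrite funeqE => y; rewrite fct_sumE -row_sum_delta.
by apply: differentiable_sum => j; exact: differentiableZl.
Qed.

(** * Holomorphy of the transition maps *)

Definition inv_first (K : fieldType) (z : 'rV[K]_3) : 'rV[K]_3 :=
  \row_(k < 3) nth 0 [:: (z$[0])^-1; z$[1]; z$[2]] k.

Lemma near_coord_neq0 (K : numFieldType) n (z : 'rV[K]_n) j :
  z 0 j != 0 -> \forall y \near z, (y : 'rV[K]_n) 0 j != 0.
Proof.
move=> z0; have : (fun y : 'rV[K]_n => y 0 j) @ z --> z 0 j.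
  exact: coord_continuous.
by move/cvgr_neq0; apply.
Qed.

Lemma differentiable_inv_first (K : numFieldType) (z : 'rV[K]_3) :
  z$[0] != 0 -> differentiable (@inv_first K) z.
Proof.
move=> z0; apply: differentiable_row => j.
rewrite /inv_first (_ : (fun y => _) = fun y : 'rV[K]_3 =>
    nth 0 [:: (y$[0])^-1; y$[1]; y$[2]] j); last first.
  by rewrite funeqE => y; rewrite mxE.
case: j => [[|[|[|]]]] //= _.
- by apply: differentiableV => //; exact: differentiable_coord.
- exact: differentiable_coord.
- exact: differentiable_coord.
Qed.

Lemma toR_coord (R : realType) (z : Cspace R 3) k : (k < 3)%N ->
  ((toR z)$[k] = complex.Re ((z : 'rV[R[i]]_3)$[k])) *
  ((toR z)$[k + 3] = complex.Im ((z : 'rV[R[i]]_3)$[k])).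
Proof.
move=> k3; rewrite /toR.
have -> : inord k = lshift 3 (inord k : 'I_3) :> 'I_(3 + 3).
  by apply: val_inj; rewrite /= !inordK// (ltn_trans k3).
have -> : inord (k + 3) = rshift 3 (inord k : 'I_3) :> 'I_(3 + 3).
  by apply: val_inj; rewrite /= !inordK// 1?addnC// -[6%N]/(3 + 3)%N ltn_add2l.
by rewrite row_mxEl row_mxEr !mxE.
Qed.

Lemma sqr_norm_eq0 (R : realType) (w : R[i]) :
  (complex.Re w ^+ 2 + complex.Im w ^+ 2 == 0) = (w == 0).
Proof.
case: w => a b /=; rewrite paddr_eq0 ?sqr_ge0// !sqrf_eq0 eq_complex//.
Qed.

Lemma stereo_transition (R : realType) (e : R) (z : Cspace R 3) :
  e ^+ 2 = 1 -> (z : 'rV[R[i]]_3)$[0] != 0 ->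
  toC (stereo (- e) (param e (toR z))) = inv_first (z : 'rV[R[i]]_3).
Proof.
move=> e1 z0.
have nz : (toR z)$[0] ^+ 2 + (toR z)$[3] ^+ 2 != 0.
  by rewrite (toR_coord z (isT : 0 < 3)%N).1 (toR_coord z (isT : 0 < 3)%N).2 sqr_norm_eq0.
rewrite (stereo_param_opp e1 nz).
have zE k (k3 : (k < 3)%N) : ((toR z)$[k] +i* (toR z)$[k + 3])%C = (z : 'rV[R[i]]_3)$[k].
  have eta (w : R[i]) : (complex.Re w +i* complex.Im w)%C = w by case: w.
  by rewrite (toR_coord z k3).2 (toR_coord z k3).1 eta.
move: (toR z) zE {nz} => u zE.
apply/rowP => k; rewrite !mxE /=.
case: k => [[|[|[|]]]] //= _; [|exact: (zE 1%N)|exact: (zE 2%N)].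
by rewrite -(zE 0%N).
Qed.

Lemma stereo_transition_id (R : realType) (e : R) (z : Cspace R 3) :
  e ^+ 2 = 1 -> toC (stereo e (param e (toR z))) = z.
Proof. by move=> e1; rewrite paramK// toRK. Qed.

(** Two charts have equal or opposite signs: the transition map is the identity
or the inversion of the first coordinate, and in the second case it is defined
only where that coordinate is nonzero. *)
Lemma stereo_transition_holomorphic (R : realType) (e f : R) :
  e ^+ 2 = 1 -> f ^+ 2 = 1 ->
  holomorphic_on
    (chart_cod (stereo_chart e) `&`
     chart_param (stereo_chart e) @^-1` chart_dom (stereo_chart f))
    (chart_coord (stereo_chart f) \o chart_param (stereo_chart e)).
Proof.
move=> e1 f1 z [_ [_ /=]].
have : f ^+ 2 == e ^+ 2 by rewrite e1 f1.
rewrite eqf_sqr => /orP[] /eqP -> {f f1} dz.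
  have -> : (toC (n:=3) \o stereo e) \o (param e \o toR (n:=3)) = id.
    by rewrite funeqE => y /=; rewrite stereo_transition_id.
  exact: ex_diff.
have z0 : (z : 'rV[R[i]]_3)$[0] != 0.
  have := stereo_dom_param_opp e1 dz.
  by rewrite (toR_coord z (isT : 0 < 3)%N).1 (toR_coord z (isT : 0 < 3)%N).2 sqr_norm_eq0.
have near_z : \forall y \near z, inv_first (y : 'rV[R[i]]_3) =
    ((toC (n:=3) \o stereo (- e)) \o (param e \o toR (n:=3))) y.
  have := near_coord_neq0 z0; apply: filterS => y y0 /=.
  by rewrite stereo_transition.
by case: (is_diff_near near_z (differentiableP (differentiable_inv_first z0))).
Qed.

(** * The induced almost complex structure *)

Lemma toR_mulI (R : realType) (w : 'rV[R]_(3 + 3)) :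
  toR ('i%C *: toC w) = \row_(j < 3 + 3)
    nth 0 [:: - w$[3]; - w$[4]; - w$[5]; w$[0]; w$[1]; w$[2]] j.
Proof.
set v := \row_(j < _) _.
suff -> : 'i%C *: toC w = toC v by rewrite toCK.
apply/rowP => k; rewrite [RHS]mxE [LHS]mxE [in LHS]mxE.
have -> : lsubmx v 0 k = - rsubmx w 0 k.
  rewrite !mxE; case: k => [[|[|[|]]]] //= lt; congr (- w 0 _);
    by apply: val_inj; rewrite /= inordK.
have -> : rsubmx v 0 k = lsubmx w 0 k.
  rewrite !mxE; case: k => [[|[|[|]]]] //= lt; congr (w 0 _);
    by apply: val_inj; rewrite /= inordK.
by apply/eqP; rewrite eq_complex /= !mul0r !mul1r sub0r add0r !eqxx.
Qed.

Lemma is_diff_sqr_coord (R : realType) n (u : 'rV[R]_n) (j : 'I_n) :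
  is_diff u (fun v : 'rV[R]_n => v 0 j ^+ 2)
    (fun w => u 0 j * w 0 j + u 0 j * w 0 j).
Proof. exact: is_diff_mul (is_diff_coord 0 j u) (is_diff_coord 0 j u). Qed.

Definition drad_param (R : realType) (u w : 'rV[R]_(3 + 3)) : R :=
  (u$[1] * w$[1] + u$[4] * w$[4] + u$[2] * w$[2] + u$[5] * w$[5]) / rad_param u.

(** The differential of rad_param / norm_param, the scalar by which inverse
stereographic projection is multiplied. *)
Definition dscale_param (R : realType) (u w : 'rV[R]_(3 + 3)) : R :=
  drad_param u w / norm_param u
  - 2 * (u$[0] * w$[0] + u$[3] * w$[3]) * rad_param u / norm_param u ^+ 2.

Lemma is_diff_scale_param (R : realType) (u : 'rV[R]_(3 + 3)) :
  is_diff u (fun v => rad_param v * (norm_param v)^-1) (dscale_param u).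
Proof.
have n0 : norm_param u != 0 by rewrite gt_eqF// norm_param_gt0.
have r0 : rad_param u != 0 by rewrite gt_eqF// rad_param_gt0.
have sq k := is_diff_sqr_coord u (inord k : 'I_6).
have c1 := is_diff_const (1 : R) u.
have da := is_diff_add (is_diff_add (is_diff_add
  (is_diff_add c1 (sq 1%N)) (sq 4%N)) (sq 2%N)) (sq 5%N).
have dr := is_diff_sqrt (f := fun v : 'rV[R]_(3 + 3) => 1 + v$[1] ^+ 2 + v$[4] ^+ 2 + v$[2] ^+ 2
  + v$[5] ^+ 2) (rad_arg_gt0 _ _ _ _) da.
have dn := is_diff_inv (f := @norm_param R) n0
  (is_diff_add (is_diff_add c1 (sq 0%N)) (sq 3%N)).
have [d dE] := is_diff_mul dr dn.
apply: DiffDef => //; rewrite dE funeqE => w.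
rewrite -/(rad_param u) -/(norm_param u) /dscale_param /drad_param.
by field; rewrite n0 r0.
Qed.

Lemma diff_param (R : realType) (e : R) (u w : 'rV[R]_(3 + 3))
    (s := rad_param u * (norm_param u)^-1) (ds := dscale_param u w) :
  'd (param e) u w = \row_(j < 7)
    nth 0 [:: 2 * (w$[0] * s + u$[0] * ds);
              2 * e * (w$[3] * s + u$[3] * ds);
              e * (2 * (u$[0] * w$[0] + u$[3] * w$[3]) * s
                   + (u$[0] ^+ 2 + u$[3] ^+ 2 - 1) * ds);
              w$[1]; w$[4]; w$[2]; w$[5]] j.
Proof.
have dp : differentiable (param e) u by apply: (Ck_param e 1).1.
have Ds := is_diff_scale_param u.
have sq k := is_diff_sqr_coord u (inord k : 'I_6).
have co k := is_diff_coord 0 (inord k : 'I_6) u.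
have cst a := is_diff_const (a : R) u.
have coE k f df : (fun v => (param e v)$[k]) = f -> is_diff u f df ->
    ('d (param e) u w)$[k] = df w.
  by move=> <-; exact: diff_coord.
apply/rowP => j; rewrite [RHS]mxE; elim/inord7_ind: j; rewrite !inordK//=.
- rewrite (coE _ _ _ _ (is_diff_mul (is_diff_mul (cst 2) (co 0%N)) Ds)).
    by rewrite -/s -/ds; ring.
  by rewrite funeqE => v; rewrite mxE inordK.
- rewrite (coE _ _ _ _ (is_diff_mul (is_diff_mul (cst (2 * e)) (co 3%N)) Ds)).
    by rewrite -/s -/ds; ring.
  by rewrite funeqE => v; rewrite mxE inordK.
- rewrite (coE _ _ _ _ (is_diff_mul (is_diff_mul (cst e)
    (is_diff_add (is_diff_add (sq 0%N) (sq 3%N)) (cst (- 1)))) Ds)).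
    by rewrite -/s -/ds; ring.
  by rewrite funeqE => v; rewrite mxE inordK.
all: apply: (fun k l fE => coE k _ _ fE (co l)).
all: by rewrite funeqE => v; rewrite mxE inordK.
Qed.

(** The contributions of the derivative of r to both sides are the same multiple
of X, and what remains says that inverse stereographic projection intertwines
multiplication by i with the cross product with the unit normal of the sphere.
After substituting e = 1 or e = - 1, both are identities between rational
functions. *)
Lemma param_holomorphic (R : realType) (e : R) (u w : 'rV[R]_(3 + 3)) :
  e ^+ 2 = 1 ->
  'd (param e) u (toR ('i%C *: toC w)) = 'd (param e) u w *m J24 (param e u).
Proof.
move=> /eqP; rewrite sqrf_eq1 => /orP e1.
have r0 : rad_param u != 0 by rewrite gt_eqF// rad_param_gt0.
have n0 : norm_param u != 0 by rewrite gt_eqF// norm_param_gt0.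
rewrite mul_J24 rad_paramE toR_mulI !diff_param /dscale_param /drad_param.
apply/rowP => j; rewrite !mxE !inordK//=.
elim/inord7_ind: j; rewrite !inordK//=.
all: rewrite /norm_param in n0 *; case: e1 => /eqP ->.
all: by field; rewrite n0 r0.
Qed.

Lemma stereo_chart_induces (R : realType) :
  induces [set stereo_chart e | e in [set e : R | e ^+ 2 = 1]] (@J24 R).
Proof.
move=> _ [e /= e1 <-] u w _ /=.
have -> : (param e \o toR (n:=3)) \o toC (n:=3) = param e.
  by rewrite funeqE => v /=; rewrite toCK.
by rewrite toCK param_holomorphic.
Qed.

(** The two domains cover because r - X2 and r + X2 have sum 2 r, which is not
zero. *)
Lemma stereo_atlas (R : realType) :
  holomorphic_atlas [set stereo_chart e | e in [set e : R | e ^+ 2 = 1]].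
Proof.
split.
- by move=> _ [e /= e1 <-]; exact: smooth_stereo_chart.
- move=> x Sx.
  have [dx|dx] := eqVneq (rad x - 1 * x$[2]) 0.
    exists (stereo_chart (- 1)); first by exists (- 1) => //=; rewrite sqrrN expr1n.
    split=> //; rewrite /stereo_dom /=.
    have -> : rad x - - 1 * x$[2] = 2 * rad x - (rad x - 1 * x$[2]) by ring.
    by rewrite dx subr0 mulf_neq0 ?pnatr_eq0// gt_eqF// rad_gt0.
  by exists (stereo_chart 1); [exists 1 => //=; rewrite expr1n|split].
- move=> _ _ [e /= e1 <-] [f /= f1 <-].
  exact: stereo_transition_holomorphic.
Qed.

Theorem mainTheorem7 (R : realType) :
  exists J : 'rV[R]_7 -> 'M[R]_7,
    almost_complex_structure J /\ integrable_structure J.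
Proof.
exists (@J24 R); split.
  split; [exact: smooth_J24| |exact: J24_sqr].
  by move=> x v Sx _; exact: J24_tangent.
exists [set stereo_chart e | e in [set e : R | e ^+ 2 = 1]].
  exact: stereo_atlas.
exact: stereo_chart_induces.
Qed.
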